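(* For a positive integer $N$ let $\Sigma=\{(t,t^2):t\in\mathbb{Z}/N\mathbb{Z}\}\subset(\mathbb{Z}/N\mathbb{Z})^2$. There exists a universal constant $C>0$ (not depending on $N$) such that for every squarefree integer $N\geq 2$ and every $f:(\mathbb{Z}/N\mathbb{Z})^2\to\mathbb{C}$, $$\left(\frac{1}{|\Sigma|}\sum_{m\in\Sigma}|\widehat{f}(m)|^2\right)^{\frac12}\leq C N^{\frac{1}{4\log\log(N)}}\cdot N^{-1}\left(\sum_{x\in(\mathbb{Z}/N\mathbb{Z})^2}|f(x)|^{\frac43}\right)^{\frac34}.$$ In particular, for every $\epsilon>0$ there exists $C_\epsilon>0$ such that for every squarefree positive integer $N$ and every $f:(\mathbb{Z}/N\mathbb{Z})^2\to\mathbb{C}$, $$\left(\frac{1}{|\Sigma|}\sum_{m\in\Sigma}|\widehat{f}(m)|^2\right)^{\frac12}\leq C_\epsilon N^\epsilon\cdot N^{-1}\left(\sum_{x\in(\mathbb{Z}/N\mathbb{Z})^2}|f(x)|^{\frac43}\right)^{\frac34}.$$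
   Context: The Fourier transform of $f:(\mathbb{Z}/N\mathbb{Z})^2\to\mathbb{C}$ is normalized by $\widehat{f}(m)=N^{-1}\sum_{x\in(\mathbb{Z}/N\mathbb{Z})^2}f(x)e^{-2\pi i x\cdot m/N}$ for $m\in(\mathbb{Z}/N\mathbb{Z})^2$, where $x\cdot m=x_1m_1+x_2m_2$. Here $\log$ is the natural logarithm. *)

(* Defs.v *)
From HB Require Import structures.
From mathcomp Require Import all_boot all_order all_algebra.
From mathcomp Require Import all_classical all_reals all_analysis.
From mathcomp Require Import complex.

Set Implicit Arguments.
Unset Strict Implicit.
Unset Printing Implicit Defensive.

Import Order.TTheory GRing.Theory Num.Theory.

Local Open Scope ring_scope.

Definition squarefree (N : nat) : Prop :=
  forall d : nat, (d ^ 2 %| N)%N -> d = 1%N.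

(* Z/NZ for every N >= 1. Unlike 'Z_N it has exactly one element when N = 1;
   its ring operations are Zp_add and Zp_mul. N = 0 is a junk value. *)
Definition residue (N : nat) : finType := 'I_N.-1.+1.

Section Definitions.
Variable R : realType.

Definition cexp (z : R[i]) : R[i] :=
  Complex (expR (complex.Re z) * cos (complex.Im z))
          (expR (complex.Re z) * sin (complex.Im z)).

Definition cabs (z : R[i]) : R := complex.Re `|z|.

Variable N : nat.

Definition dot (x m : residue N * residue N) : residue N :=
  Zp_add (Zp_mul x.1 m.1) (Zp_mul x.2 m.2).

(* The exponential is N-periodic in x . m, so it may be evaluated at the
   representative of x . m in {0, ..., N - 1}. *)
Definition fourier (f : residue N * residue N -> R[i])
    (m : residue N * residue N) : R[i] :=
  N%:R^-1 * \sum_(x : residue N * residue N)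
    f x * cexp (- 2 * (pi%:C)%C * ('i)%C * (nat_of_ord (dot x m))%:R / N%:R).

Definition parabola : {set residue N * residue N} :=
  [set (t, Zp_mul t t) | t : residue N].

End Definitions.

(* Main.v *)
Require Import Defs.
From mathcomp Require Import all_boot all_order all_algebra.
From mathcomp Require Import all_classical all_reals all_analysis.
From mathcomp Require Import complex.
From mathcomp Require Import ring lra.
Import Order.TTheory GRing.Theory Num.Theory.
Local Open Scope ring_scope.

(* Write [S] for the sum over the parabola of the squared unnormalised
   Fourier coefficients [M t]. By duality [S] is the pairing of [f] with the
   trigonometric sum [G] on the parabola with coefficients [conj (M t)], so
   Hölder bounds [S] by [||f||_(4/3) * ||G||_4]. By Plancherel [||G||_4 ^ 4 =
   ||G ^ 2||_2 ^ 2] is at most [N ^ 2 * r * S ^ 2], where [r] bounds the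
   number of ways to write a point as a sum of two points of the parabola.
   Modulo an odd prime two representations of the same point differ by a
   swap, and modulo 2 there are only two values of [t]; so for squarefree [N]
   the Chinese remainder theorem gives [r <= 2 ^ omega(N)], where [omega(N)]
   is the number of prime divisors. Finally [omega(N) * ln 2 <= ln N / ln (ln
   N)] for all large [N]. *)

(** * Arithmetic of squarefree moduli: prime divisors and sums of two parabola points *)

Lemma prod_distinct_primes_dvd (s : seq nat) (m : nat) :
  uniq s -> all prime s -> (forall p, p \in s -> p %| m)%N ->
  (\prod_(p <- s) p %| m)%N.
Proof.
elim: s => [|q s IHs] /=; first by rewrite big_nil dvd1n.
move=> /andP[qs us] /andP[qp sp] sm; rewrite big_cons Gauss_dvd.
  by rewrite sm ?mem_head // IHs // => p ps; apply: sm; rewrite inE ps orbT.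
rewrite big_seq; apply: (big_ind (coprime q)); first exact: coprimen1.
- by move=> a b ca cb; rewrite coprimeMr ca.
- move=> p ps; rewrite prime_coprime // dvdn_prime2 //.
    by apply: contra qs => /eqP ->.
  by move/allP: sp; apply.
Qed.

(** Every exponent in the factorisation of [N] is 1, so [N] is the product of its primes. This is
    the uniqueness half of the Chinese remainder theorem. *)
Lemma squarefree_dvd (N m : nat) : (0 < N)%N -> squarefree N ->
  (forall p, prime p -> p %| N -> p %| m)%N -> (N %| m)%N.
Proof.
move=> N0 sqN Hp; rewrite {1}(prod_prime_decomp N0) prime_decompE big_map /=.
have -> : (\prod_(p <- primes N) p ^ logn p N = \prod_(p <- primes N) p)%N.
  apply: eq_big_seq => p; rewrite mem_primes => /and3P[pp _ pN].
  have := logn_gt0 p N; rewrite mem_primes pp N0 pN /=.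
  case E : (logn p N) => [|[|k]] // _.
  have : (p ^ 2 %| N)%N by rewrite pfactor_dvdn // E.
  by move/sqN => p1; rewrite p1 in pp.
apply: prod_distinct_primes_dvd; first exact: primes_uniq.
- by apply/allP => p; rewrite mem_primes => /and3P[].
- by move=> p; rewrite mem_primes => /and3P[pp _ pN]; apply: Hp.
Qed.

(* Small primes each cost a factor [T], at most [T] times in total; the others
   are at least [T] themselves. *)
Lemma expn_size_primes (T N : nat) : (0 < N)%N ->
  (T ^ size (primes N) <= T ^ T * N)%N.
Proof.
move=> N0; have [->|T0] := posnP T.
  by rewrite expn0 mul1n; case: (size _) => [|k]; [move: N0|rewrite exp0n].

have le1 : (T ^ size (primes N) <=
    T ^ size [seq p <- primes N | p < T] * \prod_(p <- primes N) p)%N.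
  have: all (leq 1) (primes N).
    by apply/allP => p; rewrite mem_primes => /and3P[/prime_gt0].
  elim: (primes N) => [|p s IHs]; first by rewrite big_nil.
  move=> /= /andP[p0 /IHs {}IHs]; rewrite big_cons expnS.
  case: ltnP => pT /=.
    by rewrite expnS -mulnA leq_mul2l mulnCA (leq_trans IHs) ?leq_pmull // orbT.
  by rewrite mulnCA leq_mul.
apply: (leq_trans le1); apply: leq_mul.
  apply: leq_pexp2l => //; rewrite -[leqRHS](size_iota 0 T); apply: uniq_leq_size.
    by rewrite filter_uniq // primes_uniq.
  by move=> p; rewrite mem_filter mem_iota add0n => /andP[-> _].
apply: dvdn_leq => //; apply: prod_distinct_primes_dvd.
- exact: primes_uniq.
- by apply/allP => p; rewrite mem_primes => /and3P[].
- by move=> p; rewrite mem_primes => /and3P[].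
Qed.

(* In a field of odd characteristic the hypotheses say [(x - y) * (x - z) = 0],
   where [{y, z}] is one fixed solution; in characteristic 2 the coordinate has
   only two possible values anyway. *)
Lemma F_parabola_sums (p : nat) (x u x' u' y z : 'F_p) : prime p ->
  x + u = y + z -> x' + u' = y + z ->
  x * x + u * u = y * y + z * z -> x' * x' + u' * u' = y * y + z * z ->
  (x == y) = (x' == y) -> x = x'.
Proof.
move=> pp s1 s2 q1 q2.
case: (eqVneq x y) => [->|xy]; first by move/esym/eqP.
case: (eqVneq x' y) => [//|x'y] _.
have [p2|p2] := eqVneq p 2%N.
  subst p; move: xy x'y; clear; move: x x' y.
  by do 3!(case=> [[|[|//]] ?]); rewrite -!val_eqE //= => _ _; apply: val_inj.
have key v w : v + w = y + z -> v * v + w * w = y * y + z * z -> v != y -> v = z.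
  move=> s q vy; have E : 2 * ((v - y) * (v - z)) = 0.
    suff : v * v + w * w - (y * y + z * z) = 0.
      have -> : w = y + z - v by rewrite -s; ring.
      by move=> <-; ring.
    by rewrite q subrr.
  move/eqP: E; rewrite !mulf_eq0 !subr_eq0 (negbTE vy) /= => /orP[|/eqP//].
  rewrite -(dvdn_pcharf (pchar_Fp pp)) (dvdn_prime2 pp) // => /eqP E.
  by rewrite E in p2.
by rewrite (key _ _ s1 q1 xy) (key _ _ s2 q2 x'y).
Qed.

Lemma natrF_mod (p N k : nat) : prime p -> (p %| N)%N ->
  ((k %% N)%N%:R = k%:R :> 'F_p).
Proof.
move=> pp pN; rewrite [in RHS](divn_eq k N) natrD natrM.
have /eqP -> : N%:R == 0 :> 'F_p by rewrite -(dvdn_pcharf (pchar_Fp pp)).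
by rewrite mulr0 add0r.
Qed.

Definition parabola_sum (N : nat) (ts : residue N * residue N) :
    residue N * residue N :=
  (Zp_add ts.1 ts.2, Zp_add (Zp_mul ts.1 ts.1) (Zp_mul ts.2 ts.2)).

(** Fix one representation [(y, z)] of [a]. Any other [(t, s)] is encoded by one bit per prime [p]
    dividing [N], telling whether [t = y] modulo [p]. The bits determine [t] modulo each [p], hence
    [t], and then [s] by subtraction. *)
Lemma card_parabola_sum (N : nat) (a : residue N * residue N) : (0 < N)%N ->
  squarefree N ->
  (#|[set ts | parabola_sum N ts == a]| <= 2 ^ size (primes N))%N.
Proof.
case: N a => // n a N0 sqN; set A := [set ts | _].
have [->|[[y z] /[!inE] /eqP yzA]] := set_0Vmem A; first by rewrite cards0.
pose h (ts : residue n.+1 * residue n.+1) :=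
  map_tuple (fun p => (nat_of_ord ts.1)%:R == (nat_of_ord y)%:R :> 'F_p)
            (in_tuple (primes n.+1)).
suff h_inj : {in A &, injective h}.
  by rewrite -card_bool -card_tuple -(card_in_imset h_inj) max_card.
have modF p (ts : residue n.+1 * residue n.+1) : prime p -> (p %| n.+1)%N ->
    ts \in A ->
    let t := (nat_of_ord ts.1)%:R : 'F_p in let s := (nat_of_ord ts.2)%:R in
    let y' := (nat_of_ord y)%:R in let z' := (nat_of_ord z)%:R in
    t + s = y' + z' /\ t * t + s * s = y' * y' + z' * z'.
  rewrite inE -yzA => pp pN /eqP[E1 E2].
  have := congr1 (fun k : nat => k%:R : 'F_p) E1.
  have := congr1 (fun k : nat => k%:R : 'F_p) E2.
  by rewrite !natrF_mod // !natrD !natrF_mod // !natrM.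
(* One-sided because subtraction on [nat] is truncated: a positive difference would be a multiple of
   [n.+1] smaller than [n.+1]. *)
have h_le ts ts' : ts \in A -> ts' \in A -> h ts = h ts' -> (ts.1 <= ts'.1)%N.
  move=> tsA tsA' /(congr1 val)/eq_in_map hE; rewrite -subn_eq0 -leqn0.
  rewrite leqNgt; apply/negP => t_gt.
  have /dvdn_leq : (n.+1 %| ts.1 - ts'.1)%N.
    apply: squarefree_dvd => // p pp pN.
    have := hE p; rewrite mem_primes pp pN => /(_ isT) /= hp.
    have [s1 q1] := modF p ts pp pN tsA; have [s2 q2] := modF p ts' pp pN tsA'.
    have := F_parabola_sums _ _ _ _ _ _ _ pp s1 s2 q1 q2 hp.
    rewrite (dvdn_pcharf (pchar_Fp pp)) natrB; first by move=> ->; rewrite subrr.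
    by apply: ltnW; rewrite -subn_gt0.
  move=> /(_ t_gt); rewrite leqNgt => /negP; apply.
  by rewrite (leq_ltn_trans (leq_subr _ _)) ?ltn_ord.
move=> [t s] [t' s'] tsA tsA' hE.
have tt' : t = t'.
  apply: val_inj; apply/eqP.
  by rewrite eqn_leq (h_le _ _ tsA tsA' hE) (h_le _ _ tsA' tsA (esym hE)).
move: tsA tsA'; rewrite !inE => /eqP <- /eqP [+ _]; rewrite tt' => E.
congr (_, _); apply: (@addrI 'I_n.+1 t'); exact/esym/val_inj.
Qed.

(** * Finite Cauchy-Schwarz and Hölder inequalities *)

Lemma sum_mul_sqr_le (F : realDomainType) (I : finType) (P : pred I)
    (a b : I -> F) :
  (\sum_(i | P i) a i * b i) ^+ 2
  <= (\sum_(i | P i) a i ^+ 2) * (\sum_(i | P i) b i ^+ 2).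
Proof.
(* Lagrange's identity: this double sum is twice the gap in Cauchy-Schwarz. *)
have : 0 <= \sum_(i | P i) \sum_(j | P j) (a i * b j - a j * b i) ^+ 2.
  by do 2!(apply: sumr_ge0 => ? _); exact: sqr_ge0.
suff -> : \sum_(i | P i) \sum_(j | P j) (a i * b j - a j * b i) ^+ 2 =
    2 * ((\sum_(i | P i) a i ^+ 2) * (\sum_(i | P i) b i ^+ 2)
    - (\sum_(i | P i) a i * b i) ^+ 2).
  by rewrite pmulr_rge0 // subr_ge0.
transitivity (\sum_(i | P i) \sum_(j | P j) (a i ^+ 2 * b j ^+ 2
    + (a j ^+ 2 * b i ^+ 2 + - 2 * (a i * b i * (a j * b j))))).
  by apply: eq_bigr => i _; apply: eq_bigr => j _; ring.
under eq_bigr do rewrite !big_split /= -[X in _ + (_ + X)]mulr_sumr.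
rewrite !big_split /= -[X in _ + (_ + X)]mulr_sumr.
rewrite [X in _ + (X + _)]exchange_big /=.
by rewrite -!big_distrlr /=; ring.
Qed.

(* Hölder's inequality with exponents [4/3] and [4], for [f = phi ^ 3]. *)
Lemma sum_cube_mul_le (F : realFieldType) (I : finType) (phi g : I -> F) :
  (\sum_i phi i ^+ 3 * g i) ^+ 4
  <= (\sum_i phi i ^+ 4) ^+ 3 * \sum_i g i ^+ 4.
Proof.
set A := \sum_i phi i ^+ 4; set B := \sum_i g i ^+ 4.
have A0 : 0 <= A by apply: sumr_ge0 => i _; rewrite exprn_even_ge0.
(* Cauchy-Schwarz is used twice: on [phi ^ 2 * (phi * g)], which produces [m], and then on [m]
   itself. *)
pose m := \sum_i phi i ^+ 2 * g i ^+ 2.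
have m0 : 0 <= m by apply: sumr_ge0 => i _; rewrite mulr_ge0 ?sqr_ge0.
have E (h : I -> F) : \sum_i (h i ^+ 2) ^+ 2 = \sum_i h i ^+ 4.
  by apply: eq_bigr => i _; rewrite -exprM.
have m2 : m ^+ 2 <= A * B.
  by rewrite /A /B -!E; apply: sum_mul_sqr_le.
have s2 : (\sum_i phi i ^+ 3 * g i) ^+ 2 <= A * m.
  have := sum_mul_sqr_le _ _ predT (fun i => phi i ^+ 2) (fun i => phi i * g i).
  rewrite E; under eq_bigr do rewrite mulrA -exprSr.
  by under [X in _ <= _ * X -> _]eq_bigr do rewrite exprMn.
rewrite (exprM _ 2 2).
apply: (@le_trans _ _ ((A * m) ^+ 2)).
  by rewrite ler_sqr // nnegrE ?sqr_ge0 // mulr_ge0.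
rewrite exprMn (_ : A ^+ 3 * B = A ^+ 2 * (A * B)); last by ring.
by rewrite ler_wpM2l ?sqr_ge0.
Qed.

(** * The real-valued complex modulus *)

Section ComplexModulus.
Variable R : realType.
Implicit Types z w : R[i].

Lemma cabsE z : ((cabs z)%:C)%C = `|z|.
Proof. by rewrite /cabs normc_def. Qed.

Lemma cabs_ge0 z : 0 <= cabs z.
Proof. by rewrite -ler0c cabsE normr_ge0. Qed.

Lemma cabsM z w : cabs (z * w) = cabs z * cabs w.
Proof. by apply: complexI; rewrite rmorphM /= !cabsE normrM. Qed.

Lemma cabsX z n : cabs (z ^+ n) = cabs z ^+ n.
Proof. by apply: complexI; rewrite rmorphXn /= !cabsE normrX. Qed.

Lemma cabs_conj z : cabs z^* = cabs z.
Proof. by apply: complexI; rewrite !cabsE norm_conjC. Qed.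

Lemma cabs_sqr z : ((cabs z ^+ 2)%:C)%C = z * z^*.
Proof. by rewrite rmorphXn /= cabsE normCK. Qed.

Lemma cabs_sum (I : finType) (P : pred I) (F : I -> R[i]) :
  cabs (\sum_(i | P i) F i) <= \sum_(i | P i) cabs (F i).
Proof.
rewrite -lecR cabsE rmorph_sum /=; under [leRHS]eq_bigr do rewrite cabsE.
exact: ler_norm_sum.
Qed.

Lemma cabs_real (x : R) : 0 <= x -> cabs (x%:C)%C = x.
Proof. by move=> x0; apply: complexI; rewrite cabsE ger0_norm // ler0c. Qed.

End ComplexModulus.

(** * An abstract restriction estimate for orthogonal systems *)

Section Restriction.
Variables (R : realType) (I X A : finType) (D : R).
(** In the application [v] lists all characters, [u] those with frequency on the parabola, [phi]
    adds two parabola points, and [D] is [N ^ 2]. *)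
Variables (u : I -> X -> R[i]) (v : A -> X -> R[i]) (phi : I * I -> A).

Hypothesis u_mul : forall i j x, u i x * u j x = v (phi (i, j)) x.
Hypothesis v_orth : forall a b,
  \sum_x v a x * (v b x)^* = ((if a == b then D else 0)%:C)%C.

Lemma orth_plancherel (h : A -> R[i]) :
  \sum_x cabs (\sum_a h a * v a x) ^+ 2 = D * \sum_a cabs (h a) ^+ 2.
Proof.
apply: complexI; rewrite rmorphM !rmorph_sum /=.
under eq_bigr do rewrite cabs_sqr rmorph_sum big_distrlr /=.
rewrite exchange_big mulr_sumr /=; apply: eq_bigr => a _.
rewrite exchange_big cabs_sqr (bigD1 a) //= [X in _ + X]big1 => [|b ba].
  rewrite addr0; under eq_bigr do rewrite rmorphM mulrACA.
  by rewrite -mulr_sumr v_orth eqxx mulrC.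
under eq_bigr do rewrite rmorphM mulrACA.
by rewrite -mulr_sumr v_orth eq_sym (negbTE ba) mulr0.
Qed.

Hypothesis D_ge0 : 0 <= D.
Variable r : nat.
Hypothesis phi_fibre : forall a, (#|[set ij | phi ij == a]| <= r)%N.

(** The square of the sum expands in the [v a] with coefficients [h a], each a sum over a fibre of
    [phi]. Plancherel gives the sum of [|h a| ^ 2], and Cauchy-Schwarz on each fibre costs a factor
    [r]. *)
Lemma sum_fibre_le (c : I -> R[i]) :
  \sum_x cabs (\sum_i c i * u i x) ^+ 4
  <= D * r%:R * (\sum_i cabs (c i) ^+ 2) ^+ 2.
Proof.
pose h a := \sum_(ij | phi ij == a) c ij.1 * c ij.2.
have E x : (\sum_i c i * u i x) ^+ 2 = \sum_a h a * v a x.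
  rewrite expr2 big_distrlr pair_bigA /= (partition_big phi predT) //=.
  apply: eq_bigr => a _; rewrite mulr_suml; apply: eq_bigr => -[i j] /eqP <- /=.
  by rewrite mulrACA u_mul.
under eq_bigr do rewrite (exprM _ 2 2) -cabsX E.
rewrite orth_plancherel -mulrA ler_wpM2l //.
rewrite expr2 big_distrlr pair_bigA /= (partition_big phi predT) //= mulr_sumr.
apply: ler_sum => a _.
apply: (@le_trans _ _ ((\sum_(ij | phi ij == a) cabs (c ij.1 * c ij.2)) ^+ 2)).
  by rewrite ler_sqr ?cabs_sum // nnegrE ?sumr_ge0 // => *; exact: cabs_ge0.
have := sum_mul_sqr_le _ _ (fun ij => phi ij == a) (fun=> 1)
  (fun ij => cabs (c ij.1 * c ij.2)).
under [X in X ^+ 2 <= _ -> _]eq_bigr do rewrite mul1r.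
move=> /le_trans; apply; under [X in _ <= _ * X]eq_bigr do rewrite -exprMn -cabsM.
apply: ler_wpM2r; first by apply: sumr_ge0 => *; exact: sqr_ge0.
under eq_bigr do rewrite expr1n.
by rewrite sumr_const ler_nat (leq_trans _ (phi_fibre a)) // cardsE.
Qed.

(* The [L^(4/3) -> L^2] bound is dual to the [L^2 -> L^4] bound of
   [sum_fibre_le], applied to [c i] the conjugate of [\sum_x f x * u i x]. *)
Lemma sum_sqr_restriction_le (f : X -> R[i]) :
  (\sum_i cabs (\sum_x f x * u i x) ^+ 2) ^+ 2
  <= D * r%:R * (\sum_x cabs (f x) `^ (4 / 3)) ^+ 3.
Proof.
set S := \sum_i cabs (\sum_x f x * u i x) ^+ 2.
set A43 := \sum_x cabs (f x) `^ (4 / 3).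
have S0 : 0 <= S by apply: sumr_ge0 => *; exact: sqr_ge0.
have A0 : 0 <= A43 by apply: sumr_ge0 => *; exact: powR_ge0.
pose c i := (\sum_x f x * u i x)^*.
pose G x := \sum_i c i * u i x.
have S_dual : S <= \sum_x cabs (f x) * cabs (G x).
  have -> : S = cabs (\sum_x f x * G x).
    rewrite -[LHS]cabs_real //; congr cabs.
    rewrite rmorph_sum /=; under eq_bigr do rewrite cabs_sqr mulr_suml.
    rewrite exchange_big; apply: eq_bigr => x _; rewrite mulr_sumr.
    by apply: eq_bigr => i _; rewrite -/(c i) mulrAC mulrA.
  by under [leRHS]eq_bigr do rewrite -cabsM; exact: cabs_sum.
have S4 : S ^+ 4 <= A43 ^+ 3 * (D * r%:R * S ^+ 2).
  apply: (@le_trans _ _ ((\sum_x cabs (f x) * cabs (G x)) ^+ 4)).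
    by rewrite lerXn2r // nnegrE (le_trans S0).
  (* A cube root of [|f|], so that Hölder's inequality applies with integer powers only. *)
  pose g x := cabs (f x) `^ (3^-1).
  have g3 x : cabs (f x) = g x ^+ 3.
    rewrite -powR_mulrn ?powR_ge0 // -powRrM mulVf // powRr1 //; exact: cabs_ge0.
  have -> : A43 = \sum_x g x ^+ 4.
    by apply: eq_bigr => x _; rewrite -powR_mulrn ?powR_ge0 // -powRrM mulrC.
  under eq_bigr do rewrite g3.
  apply: (le_trans (sum_cube_mul_le _ _ g (fun x => cabs (G x)))).
  rewrite ler_wpM2l ?exprn_ge0 //.
    by apply: sumr_ge0 => *; rewrite exprn_ge0 ?powR_ge0.
  apply: (le_trans (sum_fibre_le c)); rewrite /S.
  by under eq_bigr do rewrite cabs_conj.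
(* It remains to cancel [S ^+ 2] in [S4], which requires [S] nonzero. *)
have [->|S_gt0] := eqVneq S 0.
  by rewrite expr0n /= !mulr_ge0 // exprn_ge0.
rewrite -(@ler_pM2r _ (S ^+ 2)) ?exprn_gt0 ?lt_def ?S_gt0 //.
by rewrite -exprD (le_trans S4) // mulrC mulrAC.
Qed.

End Restriction.

(** * Additive characters modulo [N] and restriction to the parabola *)

Section AdditiveCharacter.
Variable R : realType.

(** The kernel of [fourier], on natural numbers rather than residues so that additivity in [k]
    involves no reduction modulo [N]. *)
Definition echar (N k : nat) : R[i] :=
  cexp (- 2 * (pi%:C)%C * ('i)%C * k%:R / N%:R).

Lemma echarE (N k : nat) : echar N k =
  Complex (cos (2 * pi * k%:R / N%:R)) (- sin (2 * pi * k%:R / N%:R)).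
Proof.
rewrite /echar; set w := _ / _.
have -> : w = Complex 0 (- (2 * pi * k%:R / N%:R)).
  rewrite /w -[2 in LHS](rmorph_nat (real_complex R)).
  rewrite -[k%:R in LHS](rmorph_nat (real_complex R)).
  rewrite -[N%:R in LHS](rmorph_nat (real_complex R)) -fmorphV /=.
  by simpc.
by rewrite /cexp /= expR0 !mul1r cosN sinN.
Qed.

Lemma echarD (N j k : nat) : echar N (j + k) = echar N j * echar N k.
Proof.
rewrite !echarE natrD mulrDr mulrDl cosD sinD; simpc.
by congr Complex; ring.
Qed.

Lemma echarX (N k : nat) : echar N k = echar N 1 ^+ k.
Proof.
elim: k => [|k IHk]; last by rewrite exprSr -IHk -echarD addn1.
by rewrite echarE mulr0 mul0r cos0 sin0 oppr0.
Qed.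

Lemma norm_echar (N k : nat) : `|echar N k| = 1.
Proof. by rewrite normc_def echarE /= sqrrN cos2Dsin2 sqrtr1. Qed.

Lemma echar_prim (N : nat) : (0 < N)%N -> N.-primitive_root (echar N 1).
Proof.
move=> N0; apply/andP; split=> //; apply/forallP => -[k kN] /=.
have NR0 : 0 < N%:R :> R by rewrite ltr0n.
rewrite unity_rootE -echarX echarE.
have [kN1|kN1] := eqVneq k.+1 N.
  rewrite kN1 mulfK ?(gt_eqF NR0) // mulr_natl cos2pi.
  have -> : sin (pi *+ 2) = 0 :> R by rewrite sin_mulr2n sinpi mulr0 mul0rn.
  by rewrite oppr0 eqxx.
have {}kN : (k.+1 < N)%N by rewrite ltn_neqAle kN1.
rewrite eqbF_neg eq_complex /= negb_and; apply/orP; left.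
(* Half the angle lies strictly between 0 and pi, so the real part [1 - 2 * sin a ^ 2] is less than
   1. *)
set a := pi * k.+1%:R / N%:R : R.
have -> : 2 * pi * k.+1%:R / N%:R = a *+ 2 :> R by rewrite -[RHS]mulr_natl !mulrA.
have sa : 0 < sin a.
  apply: sin_gt0_pi; rewrite divr_gt0 ?mulr_gt0 ?pi_gt0 ?ltr0n //=.
  by rewrite ltr_pdivrMr // ltr_pM2l ?pi_gt0 // ltr_nat.
rewrite cos_mulr2n cos2sin2 lt_eqF //.
have : 0 < sin a ^+ 2 by rewrite exprn_gt0.
rewrite mulr2n; lra.
Qed.

Lemma echar_mod (N k : nat) : (0 < N)%N -> echar N (k %% N) = echar N k.
Proof.
by move=> N0; rewrite (echarX N (_ %% _)) (echarX N k) prim_expr_mod ?echar_prim.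
Qed.

Lemma echar_modM (N j k : nat) : (0 < N)%N ->
  echar N (j * (k %% N)) = echar N (j * k).
Proof. by move=> N0; rewrite -echar_mod // modnMmr echar_mod. Qed.

(** A geometric sum whose ratio [w] is an [N]-th root of unity, equal to 1 only if [a = b]. *)
Lemma echar_orth (N : nat) (a b : 'I_N) :
  \sum_(x < N) echar N (x * a) * (echar N (x * b))^* = N%:R * (a == b)%:R.
Proof.
case: N a b => [[] //|n] a b; set N := n.+1.
pose w := echar N a * (echar N b)^*.
have -> : \sum_(x < N) echar N (x * a) * (echar N (x * b))^* = \sum_(x < N) w ^+ x.
  apply: eq_bigr => x _; rewrite exprMn -rmorphXn /= !(echarX N (_ * _)).
  by rewrite (echarX N a) (echarX N b) -!exprM !(mulnC x).
have bV : (echar N b)^* = (echar N b)^-1.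
  by rewrite invC_norm norm_echar expr1n invr1 mul1r.
have b0 : echar N b != 0 by rewrite -normr_gt0 norm_echar.
have [ab|ab] := eqVneq a b.
  have -> : w = 1 by rewrite /w bV ab mulfV.
  by under eq_bigr do rewrite expr1n; rewrite sumr_const card_ord mulr1.
have w1 : w != 1.
  rewrite /w bV; apply: contra ab => /eqP E.
  have : echar N a = echar N b by rewrite -[RHS]mul1r -E divfK.
  move=> /eqP; rewrite (echarX N a) (echarX N b).
  by rewrite (eq_prim_root_expr (echar_prim N isT)) !modn_small.
have wN : w ^+ N = 1.
  rewrite exprMn -rmorphXn /= (echarX N a) (echarX N b) -!exprM.
  rewrite ![(_ * N)%N]mulnC !exprM.
  by rewrite (prim_expr_order (echar_prim N isT)) !expr1n rmorph1 mulr1.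
apply: (@mulfI _ (w - 1)); first by rewrite subr_eq0.
by rewrite -subrX1 wN subrr !mulr0.
Qed.

Lemma echar_dot (N : nat) (x m : residue N * residue N) :
  (0 < N)%N -> echar N (dot x m) = echar N (x.1 * m.1) * echar N (x.2 * m.2).
Proof.
by case: N x m => // n x m _; rewrite /dot /= !echar_mod // echarD !echar_mod.
Qed.

Lemma echar_dot_orth (N : nat) (a b : residue N * residue N) : (0 < N)%N ->
  \sum_x echar N (dot x a) * (echar N (dot x b))^*
  = ((if a == b then N%:R ^+ 2 else 0)%:C)%C.
Proof.
case: N a b => // n [a1 a2] [b1 b2] _.
under eq_bigr do rewrite !echar_dot // rmorphM mulrACA.
have /= := pair_bigA _ (fun x1 x2 : 'I_n.+1 =>
  echar n.+1 (x1 * a1) * (echar n.+1 (x1 * b1))^* *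
  (echar n.+1 (x2 * a2) * (echar n.+1 (x2 * b2))^*)).
move=> <-; rewrite -big_distrlr /= !echar_orth xpair_eqE.
case: (a1 == b1); case: (a2 == b2); rewrite /= ?mulr0 ?mul0r //.
by rewrite !mulr1 rmorphXn /= rmorph_nat.
Qed.

Lemma echar_parabola_sum (N : nat) (s t : residue N) x : (0 < N)%N ->
  echar N (dot x (s, Zp_mul s s)) * echar N (dot x (t, Zp_mul t t))
  = echar N (dot x (parabola_sum N (s, t))).
Proof.
case: N s t x => // n s t x _; rewrite !echar_dot //= !echar_modM //.
by rewrite !mulnDr !echarD !echar_modM // mulrACA.
Qed.

Lemma fourierE (N : nat) (f : residue N * residue N -> R[i]) m :
  fourier f m = N%:R^-1 * \sum_x f x * echar N (dot x m).
Proof. by []. Qed.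

Lemma sum_parabola (N : nat) (F : residue N * residue N -> R) :
  \sum_(m in parabola N) F m = \sum_(t : residue N) F (t, Zp_mul t t).
Proof. by rewrite big_imset //= => s t _ _ []. Qed.

Lemma card_parabola (N : nat) : (0 < N)%N -> #|parabola N| = N.
Proof.
by case: N => // n _; rewrite card_imset ?card_ord // => s t [].
Qed.

Lemma parabola_restriction (N : nat) (f : residue N * residue N -> R[i]) :
  (0 < N)%N -> squarefree N ->
  ((#|parabola N|%:R)^-1 * \sum_(m in parabola N) cabs (fourier f m) ^+ 2)
    `^ (1 / 2)
  <= (2 ^ size (primes N))%:R `^ (1 / 4) * N%:R^-1 *
     (\sum_(x : residue N * residue N) cabs (f x) `^ (4 / 3)) `^ (3 / 4).
Proof.
move=> N0 sqN; rewrite card_parabola // sum_parabola.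
have NR0 : 0 < N%:R :> R by rewrite ltr0n.
set A43 := \sum_x _ `^ _.
pose S := \sum_(t : residue N)
  cabs (\sum_x f x * echar N (dot x (t, Zp_mul t t))) ^+ 2.
have S0 : 0 <= S by apply: sumr_ge0 => *; exact: sqr_ge0.
have A0 : 0 <= A43 by apply: sumr_ge0 => *; exact: powR_ge0.
have S2 : S ^+ 2 <= N%:R ^+ 2 * (2 ^ size (primes N))%:R * A43 ^+ 3.
  apply: (@sum_sqr_restriction_le _ _ _ _ _ _
    (fun a x => echar N (dot x a)) (parabola_sum N)).
  - by move=> s t x; exact: echar_parabola_sum.
  - by move=> a b; exact: echar_dot_orth.
  - by rewrite exprn_ge0.
  - by move=> a; exact: card_parabola_sum.
(* One factor [N^-1] comes from the average and two from the squared normalisation of [fourier]. *)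
have -> : N%:R^-1 * \sum_(t : residue N) cabs (fourier f (t, Zp_mul t t)) ^+ 2
    = N%:R^-1 ^+ 3 * S.
  rewrite exprS -mulrA; congr (_ * _); rewrite mulr_sumr; apply: eq_bigr => t _.
  rewrite fourierE cabsM exprMn; congr (_ ^+ _ * _).
  rewrite -[N%:R in LHS](rmorph_nat (real_complex R)) -fmorphV /= cabs_real //.
have Q0 : 0 <= N%:R^-1 ^+ 3 * S by rewrite mulr_ge0 // exprn_ge0 // invr_ge0 ltW.
(* Both sides become fourth roots; the bases are compared through [S2], where
   [N^-6 * N^2 = N^-4]. *)
have -> : (1 / 2 : R) = 2%:R * (1 / 4) by field.
rewrite powRrM powR_mulrn //.
have NV : N%:R^-1 = (N%:R^-1 ^+ 4) `^ (1 / 4) :> R.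
  by rewrite -powR_mulrn // -powRrM mulrC divfK // powRr1.
rewrite [X in _ <= _ * X * _]NV.
have -> : A43 `^ (3 / 4) = (A43 ^+ 3) `^ (1 / 4).
  by rewrite -powR_mulrn // -powRrM mulrA mulr1.
have V4 : 0 <= N%:R^-1 ^+ 4 :> R by rewrite exprn_ge0 // invr_ge0 ltW.
rewrite -!powRM ?mulr_ge0 ?exprn_ge0 //.
apply: ge0_ler_powR; rewrite ?nnegrE ?mulr_ge0 ?exprn_ge0 // ?divr_ge0 //.
rewrite exprMn -exprM.
apply: (@le_trans _ _ (N%:R^-1 ^+ 6 *
  (N%:R ^+ 2 * (2 ^ size (primes N))%:R * A43 ^+ 3))).
  by rewrite ler_wpM2l // exprn_ge0 // invr_ge0 ltW.
by rewrite le_eqVlt; apply/orP; left; apply/eqP; field; exact: lt0r_neq0.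
Qed.

End AdditiveCharacter.

(** * Growth of the number of prime divisors *)

Section PrimeDivisorBound.
Variable R : realType.

Lemma ln2_le34 : ln 2 <= 3 / 4 :> R.
Proof.
rewrite -ler_expR lnK ?posrE //.
have -> : 3 / 4 = 8%:R * (3 / 32) :> R by field.
rewrite expRM_natl.
apply: (@le_trans _ _ ((1 + 3 / 32) ^+ 8)); first by lra.
by rewrite lerXn2r ?nnegrE ?expR_ge0 ?expR_ge1Dx //; lra.
Qed.

Lemma ex_nat_between (x : R) : 0 <= x -> exists2 n : nat, x < n%:R & n%:R <= x + 1.
Proof.
move=> x0; have /andP[h1 h2] := truncn_itv x0.
by exists (Num.truncn x).+1 => //; rewrite -natr1 lerD2r.
Qed.

(** The threshold is [1344 = 128 * 21 / 2], from [y ^ 2 / 128 >= 21 / 2 * y]. *)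
Lemma quadratic_ge (y : R) : 1344 <= y -> 21 / 2 * y <= 1 + (y / 8) ^+ 2 / 2.
Proof.
move=> y_ge; have : 0 <= y * (y - 1344) by rewrite mulr_ge0 ?subr_ge0 //; lra.
rewrite exprMn expr2 mulrBr; move: (y * y) => Y; lra.
Qed.

(* Take [expn_size_primes] with [T] about [(ln N) ^ (7/8)]; any exponent strictly
   between [ln 2] and [1] would do. The threshold makes
   [(y / 8) ^ 2 / 2 >= (21 / 2) * y], hence [exp (y / 8) >= (21 / 2) * y], for
   [y = ln (ln N)]. *)
Lemma size_primes_le (N : nat) : 1344 <= ln (ln N%:R) :> R ->
  (size (primes N))%:R * ln 2 <= ln N%:R / ln (ln N%:R) :> R.
Proof.
set L := ln N%:R; set y := ln L => y_ge.
have y0 : 0 < y by lra.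
(* [ln] is 0 on nonpositive arguments, so a large [y] forces [L] and then [N] to be positive. *)
have L0 : 0 < L by rewrite ltNge; apply/negP => /ln0; rewrite -/y; lra.
have N0 : (0 < N)%N.
  by case: posnP => // N0; move: L0; rewrite /L N0 ln0 ?ltxx.
pose X := expR (7 / 8 * y).
have LE : L = X * expR (y / 8).
  rewrite -expRD -[LHS]lnK ?posrE // -/y.
  by congr expR; field.
have X1 : 1 <= X by rewrite -expR0 ler_expR; lra.
have [T XT TX] := ex_nat_between X (le_trans ler01 X1).
have T0 : 0 < T%:R :> R by lra.
have TX0 k : 0 < T%:R ^+ k :> R by rewrite exprn_gt0.
have NR0 : 0 < N%:R :> R by rewrite ltr0n.
have lnT : 7 / 8 * y <= ln T%:R.
  by rewrite -[leLHS]expRK ler_ln ?posrE ?expR_gt0 // ltW.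
have wT : (size (primes N))%:R * ln T%:R <= T%:R * ln T%:R + L.
  have := expn_size_primes T N N0; rewrite -(ler_nat R) natrM !natrX => hT.
  rewrite -ler_ln ?posrE ?mulr_gt0 // lnM ?posrE // !lnXn // in hT.
  by rewrite -!(mulr_natl (ln _)) in hT.
have Xy : 21 / 2 * y * X <= L.
  rewrite LE [leRHS]mulrC ler_wpM2r ?(le_trans ler01) //.
  have /(_ (ltW _)) := expR_ge1Dxn 1 (_ : 0 <= y / 8); rewrite divr_gt0 // => /(_ isT).
  apply: le_trans; rewrite (_ : 2`!%:R = 2 :> R) //.
  exact: quadratic_ge.
set w : R := (size _)%:R in wT *.
have w0 : 0 <= w by rewrite ler0n.
have {}wT : w <= 2 * X + 8 / 7 * (L / y).
  (* For [w > T], lower [ln T] to [7 / 8 * y] in [wT]; otherwise the left side is nonpositive. *)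
  have : (w - T%:R) * (7 / 8 * y) <= L.
    have [wT0|wT0] := leP (w - T%:R) 0; first by nra.
    apply: (@le_trans _ _ ((w - T%:R) * ln T%:R)); first by rewrite ler_pM2l.
    lra.
  have LQ : L = 7 / 8 * y * (8 / 7 * (L / y)) by field; exact: lt0r_neq0.
  rewrite mulrC [X in _ <= X -> _]LQ ler_pM2l; last by lra.
  move: (8 / 7 * (L / y)) => Q; lra.
have {}Xy : 21 / 2 * X <= L / y by rewrite ler_pdivlMr // mulrAC.
(* Here [2 * X <= 4 / 21 * (L / y)], and [4 / 21 + 8 / 7 = 4 / 3] exactly offsets the bound [3 / 4]
   for [ln 2]. *)
apply: (le_trans (ler_wpM2l w0 ln2_le34)).
by move: (L / y) Xy wT => Q; lra.
Qed.

Lemma ln_ln_nat_ge (y : R) :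
  exists N0 : nat, forall N, (N0 <= N)%N -> y <= ln (ln N%:R).
Proof.
exists (Num.bound (expR (expR y))) => N N0N.
have {}N0N : expR (expR y) <= N%:R.
  apply: (@le_trans _ _ (Num.bound (expR (expR y)))%:R); last by rewrite ler_nat.
  by rewrite ltW // archi_boundP ?expR_ge0.
have N_gt0 : 0 < N%:R :> R by apply: lt_le_trans N0N; exact: expR_gt0.
have lnN : expR y <= ln N%:R by rewrite -ler_expR lnK.
by rewrite -ler_expR lnK // posrE (lt_le_trans _ lnN) ?expR_gt0.
Qed.

Lemma size_primes_powR_le (N : nat) : 1344 <= ln (ln N%:R) :> R ->
  (2 ^ size (primes N))%:R `^ (1 / 4)
  <= N%:R `^ (1 / (4 * ln (ln N%:R))) :> R.
Proof.
move=> y_ge; have N0 : (0 < N)%N.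
  by case: posnP => // N0; move: y_ge; rewrite N0 !ln0 //; lra.
rewrite -ler_ln ?posrE ?powR_gt0 ?ltr0n ?expn_gt0 // !ln_powR.
rewrite natrX lnXn // -[ln 2 *+ _]mulr_natl.
have := size_primes_le N y_ge.
have -> : 1 / (4 * ln (ln N%:R)) * ln N%:R = 1 / 4 * (ln N%:R / ln (ln N%:R)) :> R.
  by field; apply: lt0r_neq0; lra.
by move=> h; rewrite ler_pM2l.
Qed.

(** Only finitely many ratios [K i / B i] precede the threshold; their absolute sum bounds each of
    them, and the added 1 serves the large [N]. *)
Lemma eventually_le_bound (K B : nat -> R) (N0 : nat) :
  (forall N, (N0 <= N)%N -> K N <= B N) -> (forall N, (0 < N)%N -> 0 < B N) ->
  exists2 C, 0 < C & forall N, (0 < N)%N -> K N <= C * B N.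
Proof.
move=> KB B0; pose S := \sum_(i < N0) `|K i / B i|.
have S0 : 0 <= S by apply: sumr_ge0.
exists (1 + S) => [|N N_gt0]; first by lra.
have BN := B0 N N_gt0.
have [/KB h|NN0] := leqP N0 N.
  by apply: (le_trans h); rewrite ler_peMl ?(ltW BN) // lerDl.
rewrite -ler_pdivrMr //; apply: (le_trans (ler_norm _)).
rewrite /S (bigD1 (Ordinal NN0)) //= addrCA lerDl addr_ge0 //.
exact: sumr_ge0.
Qed.

End PrimeDivisorBound.

(** * Absorbing the small moduli into the constants *)

Theorem corollary2p4 (R : realType) :
  (exists C : R, 0 < C /\
    forall N : nat, (2 <= N)%N -> squarefree N ->
    forall f : residue N * residue N -> R[i],
      ((#|parabola N|%:R)^-1 * \sum_(m in parabola N) cabs (fourier f m) ^+ 2)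
        `^ (1 / 2)
      <= C * N%:R `^ (1 / (4 * ln (ln N%:R))) * N%:R^-1 *
         (\sum_(x : residue N * residue N) cabs (f x) `^ (4 / 3)) `^ (3 / 4))
  /\
  (forall eps : R, 0 < eps -> exists Ceps : R, 0 < Ceps /\
    forall N : nat, (0 < N)%N -> squarefree N ->
    forall f : residue N * residue N -> R[i],
      ((#|parabola N|%:R)^-1 * \sum_(m in parabola N) cabs (fourier f m) ^+ 2)
        `^ (1 / 2)
      <= Ceps * N%:R `^ eps * N%:R^-1 *
         (\sum_(x : residue N * residue N) cabs (f x) `^ (4 / 3)) `^ (3 / 4)).
Proof.
pose K N : R := (2 ^ size (primes N))%:R `^ (1 / 4).
have transfer (N : nat) (c : R) (f : residue N * residue N -> R[i]) :
    (0 < N)%N -> squarefree N -> K N <= c ->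
    ((#|parabola N|%:R)^-1 * \sum_(m in parabola N) cabs (fourier f m) ^+ 2)
      `^ (1 / 2)
    <= c * N%:R^-1 *
       (\sum_(x : residue N * residue N) cabs (f x) `^ (4 / 3)) `^ (3 / 4).
  move=> N0 sqN Kc; apply: (le_trans (parabola_restriction _ _ f N0 sqN)).
  by rewrite ler_wpM2r ?powR_ge0 // ler_wpM2r.
split.
  have [N0 N0P] := ln_ln_nat_ge R 1344.
  (* At [N = 2] the exponent is negative, but below the threshold only positivity of the bound
     matters. *)
  have [|N N_gt0|C C0 CP] := eventually_le_bound R K
    (fun N => N%:R `^ (1 / (4 * ln (ln N%:R)))) N0.
  - by move=> N /N0P; exact: size_primes_powR_le.
  - by apply: powR_gt0; rewrite ltr0n.
  exists C; split=> // N N2 sqN f; have N_gt0 := ltnW N2.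
  by apply: transfer => //; exact: CP.
move=> eps eps0.
(* The summand [eps^-1] makes [1 / (4 * ln (ln N)) <= eps]; the threshold [N0.+1] ensures [1 <= N],
   so that powers of [N] grow with the exponent. *)
have [N0 N0P] := ln_ln_nat_ge R (1344 + eps^-1).
have [|N N_gt0|C C0 CP] := eventually_le_bound R K (fun N => N%:R `^ eps) N0.+1.
- move=> N NN0; have y_ge := N0P N (leq_trans (leqnSn _) NN0).
  have ie : 0 < eps^-1 by rewrite invr_gt0.
  have y0 : 0 < ln (ln N%:R) :> R by lra.
  apply: (le_trans (size_primes_powR_le _ N _)); first by lra.
  apply: ler_powR; first by rewrite ler1n (leq_ltn_trans _ NN0).
  rewrite ler_pdivrMr ?mulr_gt0 // mulrC -ler_pdivrMr // div1r; lra.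
- by apply: powR_gt0; rewrite ltr0n.
by exists C; split=> // N N_gt0 sqN f; apply: transfer => //; exact: CP.
Qed.
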